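(* Let $T,k\ge 1$ be integers, $\tau\in(0,1)$, $\mathcal B\subseteq\mathbb R^k$, and let $P^{\mathrm{obs}}$ be a Borel probability law of $(Y,X)$ with $Y=(Y_1,\dots,Y_T)'\in\mathbb R^T$ and $X=(X_1,\dots,X_T)$, $X_t\in\mathbb R^k$. Let $\Theta_I^{\mathrm{str}}$ be the structural sharp identified set and $\mathcal C_b(P^{\mathrm{obs}})$ the set of feasible latent couplings at $b$ (both defined in the context). Then $$\Theta_I^{\mathrm{str}}=\Theta_I^{\mathrm{coup}}:=\{b\in\mathcal B:\ \mathcal C_b(P^{\mathrm{obs}})\neq\varnothing\}.$$ Consequently the right-hand side is the sharp identified set: every $b$ in it is rationalized by an admissible structural law, and no $b\in\mathcal B$ outside it admits an admissible structural law.
   Context: Admissible structural law. For $b\in\mathcal B$, let $\mathfrak S(b)$ be the collection of all Borel probability laws $P^{\mathrm s}$ of $(Y,X,A,U)$, with $A\in\mathbb R$ and $U=(U_1,\dots,U_T)'\in\mathbb R^T$, such that: (i) the $(Y,X)$-marginal of $P^{\mathrm s}$ is $P^{\mathrm{obs}}$; (ii) $Y_t=X_t'b+A+U_t$ holds $P^{\mathrm s}$-a.s. for every $t=1,\dots,T$; (iii) $P^{\mathrm s}(U_t\le 0\mid X,A)\ge\tau$ and $P^{\mathrm s}(U_t<0\mid X,A)\le\tau$ hold $P^{\mathrm s}$-a.s. for every $t$. Define $\Theta_I^{\mathrm{str}}=\{b\in\mathcal B:\mathfrak S(b)\ne\varnothing\}$. Feasible latent coupling. Put $R_t(b)=Y_t-X_t'b$.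 $\mathcal C_b(P^{\mathrm{obs}})$ is the set of all Borel probability laws $\pi$ of $(Y,X,A)$, $A\in\mathbb R$, whose $(Y,X)$-marginal is $P^{\mathrm{obs}}$ and which satisfy, for every $t=1,\dots,T$, $\pi$-a.s., $\pi\{R_t(b)\le A\mid X,A\}\ge\tau$ and $\pi\{R_t(b)<A\mid X,A\}\le\tau$. *)

(* Defs.v *)
From HB Require Import structures.
From mathcomp Require Import all_boot all_order all_algebra.
From mathcomp Require Import all_classical all_reals all_analysis.

Set Implicit Arguments.
Unset Strict Implicit.
Unset Printing Implicit Defensive.

Import Order.TTheory GRing.Theory Num.Theory.
Local Open Scope classical_set_scope.
Local Open Scope ring_scope.

(* Euclidean spaces are tuples: R^n is n.-tuple R, with the product
   sigma-algebra of the Borel sigma-algebra of R, which is the Borel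
   sigma-algebra of R^n because R is second countable; likewise for the binary
   products below. Probability laws on these types are thus Borel laws. *)
Notation obs_space R T k := (T.-tuple R * T.-tuple (k.-tuple R))%type
  (only parsing).
(* ((y, x), a) *)
Notation latent_space R T k := (obs_space R T k * R)%type (only parsing).
(* (((y, x), a), u) *)
Notation struct_space R T k := (latent_space R T k * T.-tuple R)%type
  (only parsing).

(* g is a version of the conditional probability P(E | Z), that is, of
   P(E | sigma(Z)). *)
Definition is_cond_prob d d' (Omega : measurableType d) (S : measurableType d')
    (R : realType) (P : probability Omega R) (Z : Omega -> S) (E : set Omega)
    (g : Omega -> R) : Prop :=
  [/\ measurable_fun [set: g_sigma_algebra_preimageType Z] g,
      P.-integrable [set: Omega] (EFin \o g) &
      forall B : set Omega, g_sigma_algebra_preimage Z B ->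
        (\int[P]_(w in B) (g w)%:E = P (E `&` B))%E].

(* "Q (P(E | Z)) holds P-a.s.". Versions of P(E | Z) exist and are P-a.s.
   equal, so it does not matter which one is used. *)
Definition cond_prob_as d d' (Omega : measurableType d) (S : measurableType d')
    (R : realType) (P : probability Omega R) (Z : Omega -> S) (E : set Omega)
    (Q : R -> Prop) : Prop :=
  exists2 g : Omega -> R,
    is_cond_prob P Z E g & {ae P, forall w, Q (g w)}.

(* Set functions are only compared on measurable sets: their values elsewhere
   carry no meaning. *)
Definition has_law d d' (Omega : measurableType d) (S : measurableType d')
    (R : realType) (P : probability Omega R) (f : Omega -> S)
    (Q : probability S R) : Prop :=
  forall B : set S, measurable B -> pushforward P f B = Q B.

Definition dot (R : realType) (k : nat) (x b : k.-tuple R) : R :=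
  \sum_(j < k) tnth x j * tnth b j.

Section identified_sets.
Context (R : realType) (T k : nat).
Variables (tau : R) (Pobs : probability (obs_space R T k) R).
Implicit Type b : k.-tuple R.

Definition structural_laws b : set (probability (struct_space R T k) R) :=
  [set Ps |
    let Y := fun w : struct_space R T k => w.1.1.1 in
    let X := fun w : struct_space R T k => w.1.1.2 in
    let A := fun w : struct_space R T k => w.1.2 in
    let U := fun w : struct_space R T k => w.2 in
    let XA := fun w => (X w, A w) in
    [/\ has_law Ps (fun w => (Y w, X w)) Pobs,
        forall t : 'I_T,
          {ae Ps, forall w,
             tnth (Y w) t = dot (tnth (X w) t) b + A w + tnth (U w) t} &
        forall t : 'I_T,
          cond_prob_as Ps XA [set w | tnth (U w) t <= 0] (fun p => tau <= p) /\
          cond_prob_as Ps XA [set w | tnth (U w) t < 0] (fun p => p <= tau)]].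

Definition feasible_couplings b : set (probability (latent_space R T k) R) :=
  [set pi |
    let Y := fun w : latent_space R T k => w.1.1 in
    let X := fun w : latent_space R T k => w.1.2 in
    let A := fun w : latent_space R T k => w.2 in
    let XA := fun w => (X w, A w) in
    let Res := fun w t => tnth (Y w) t - dot (tnth (X w) t) b in
    has_law pi (fun w => (Y w, X w)) Pobs /\
    forall t : 'I_T,
      cond_prob_as pi XA [set w | Res w t <= A w] (fun p => tau <= p) /\
      cond_prob_as pi XA [set w | Res w t < A w] (fun p => p <= tau)].

Definition theta_str (calB : set (k.-tuple R)) : set (k.-tuple R) :=
  [set b | calB b /\ structural_laws b !=set0].

Definition theta_coup (calB : set (k.-tuple R)) : set (k.-tuple R) :=
  [set b | calB b /\ feasible_couplings b !=set0].

End identified_sets.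

(* Main.v *)
(* Both inclusions are pushforwards. A structural law is sent to a coupling by
   forgetting U; a coupling is sent to a structural law by the graph map
   U_t := Y_t - X_t'b - A, for which the outcome equation holds identically.
   The maps commute with (X, A), so conditional probabilities given (X, A) are
   carried over, and U_t <= 0 is the same event as Y_t - X_t'b <= A almost
   surely (likewise for the strict inequalities). *)
Require Import Defs.
From HB Require Import structures.
From mathcomp Require Import all_boot all_order all_algebra.
From mathcomp Require Import all_classical all_reals all_analysis.
From mathcomp Require Import measurable_realfun.

Set Implicit Arguments.
Unset Strict Implicit.
Unset Printing Implicit Defensive.

Import Order.TTheory GRing.Theory Num.Theory.
Local Open Scope classical_set_scope.
Local Open Scope ring_scope.

Lemma measurable_bool_set d (T : measurableType d) (f : T -> bool) :
  measurable_fun [set: T] f -> measurable [set x | f x].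
Proof. by move=> mf; rewrite -[X in measurable X]setTI; exact: mf. Qed.

(** The measure of a set is the integral of its indicator, and the two indicators agree almost
    everywhere. *)
Lemma measure_ae_iff d (T : measurableType d) (R : realType)
    (mu : {measure set T -> \bar R}) (A B : set T) :
  measurable A -> measurable B -> {ae mu, forall x, A x <-> B x} ->
  mu A = mu B.
Proof.
move=> mA mB AB; rewrite -(setIT A) -(setIT B) -!integral_indic//.
apply: ae_eq_integral => //; [exact/measurable_EFinP/measurable_indic..|].
apply: filterS AB => x AB _ /=; rewrite !indicE; congr (_%:R%:E).
by congr nat_of_bool; apply/idP/idP; rewrite !inE => /AB.
Qed.

(** As [A] is measurable, its complement has a mass under the distribution, namely the [P]-mass of
    its preimage, which is zero. *)
Lemma ae_distribution d d' (T : measurableType d) (T' : measurableType d')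
    (R : realType) (P : probability T R) (phi : {mfun T >-> T'}) (A : set T') :
  measurable A -> {ae P, forall x, A (phi x)} ->
  {ae distribution P phi, forall y, A y}.
Proof.
move=> mA PA; have PCA : P (phi @^-1` (~` A)) = 0%E.
  apply: measure_negligible; last exact: PA.
  by apply: measurable_funPTI; exact: measurableC.
by apply/negligibleP => //; exact: measurableC.
Qed.

(** The level set of [g] through [y] belongs to sigma(Z), hence is a preimage under [Z] and contains
    the whole fibre of [y]. This is the set-theoretic part of Doob-Dynkin factorization. *)
Lemma g_sigma_algebra_preimage_fiber d (T : pointedType) (S : measurableType d)
    (R : realType) (Z : T -> S) (g : g_sigma_algebra_preimageType Z -> R)
    (x y : T) :
  measurable_fun [set: g_sigma_algebra_preimageType Z] g ->
  Z x = Z y -> g x = g y.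
Proof.
move=> mg Zxy; have [] := mg measurableT [set g y] (measurable_set1 _).
move=> B mB; rewrite !setTI => /seteqP[BZ ZB].
by apply: BZ; rewrite /preimage/= Zxy; exact: ZB.
Qed.

(* A version g of P(E | Z) is constant on the fibres of Z, so g \o s is a
   function of Z' that agrees with g along phi; s need not be measurable. *)
Lemma cond_prob_as_distribution d d' d'' (Omega : measurableType d)
    (Omega' : measurableType d') (S : measurableType d'') (R : realType)
    (P : probability Omega R) (phi : {mfun Omega >-> Omega'})
    (s : Omega' -> Omega) (Z : Omega -> S) (Z' : Omega' -> S)
    (E : set Omega) (E' : set Omega') (Q : set R) :
  measurable_fun [set: Omega'] Z' ->
  (forall w, Z' (phi w) = Z w) -> (forall w, Z (s w) = Z' w) ->
  measurable E -> measurable E' -> {ae P, forall w, E w <-> E' (phi w)} ->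
  measurable Q ->
  cond_prob_as P Z E Q -> cond_prob_as (distribution P phi) Z' E' Q.
Proof.
move=> mZ' Z'phi Zs mE mE' EE' mQ [g [mg ig gE] Qg].
have gsphi : (g \o s) \o phi = g.
  apply/funext => w /=; apply: (g_sigma_algebra_preimage_fiber mg).
  by rewrite Zs Z'phi.
have mgs : measurable_fun [set: g_sigma_algebra_preimageType Z'] (g \o s).
  (* The preimage of [C] under [g] is that of some measurable [B] under [Z]. Pulling back along [s]
     gives the preimage of [B] under [Z'], because [Z] after [s] is [Z']. *)
  move=> _ C mC; have [B mB] := mg measurableT C mC.
  rewrite !setTI => ZB; exists B => //; rewrite setTI.
  rewrite -[RHS]/(s @^-1` (g @^-1` C)) -ZB.
  by rewrite -[RHS]/((fun w => Z (s w)) @^-1` B) (funext Zs).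
have sub B : g_sigma_algebra_preimage Z' B -> measurable B.
  by case=> C mC <-; exact: mZ'.
have mgs' : measurable_fun [set: Omega'] (g \o s).
  by move=> _ C mC; exact/sub/mgs.
have mEgs : measurable_fun [set: Omega'] (EFin \o (g \o s)).
  exact/measurable_EFinP.
have igs : P.-integrable [set: Omega] ((EFin \o (g \o s)) \o phi).
  by rewrite -compA gsphi.
exists (g \o s).
  split=> //; first exact: integrable_pushforward.
  move=> B Z'B; have mB := sub _ Z'B.
  have mpB : measurable (phi @^-1` B) by exact: measurable_funPTI.
  (* Change of variables leaves the integral of [g] over the preimage of [B] under [phi]. That event
     lies in sigma(Z), since [Z'] after [phi] is [Z], so [gE] applies. *)
  rewrite integral_pushforward//; last exact: integrableS igs.
  under eq_integral do rewrite [_ _]/= -[g _]/(((g \o s) \o phi) _) gsphi.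
  rewrite gE; last first.
    case: Z'B => C mC <-; exists C => //; rewrite !setTI.
    by rewrite -[RHS]/((fun w => Z' (phi w)) @^-1` C) (funext Z'phi).
  (* What remains compares two events that differ by a null set, by [EE']. *)
  rewrite [RHS]/(P ((phi @^-1` E') `&` (phi @^-1` B))).
  apply: measure_ae_iff; [exact: measurableI| |].
    by apply: measurableI => //; exact: measurable_funPTI.
  by apply: filterS EE' => w EE'; split=> -[/EE'].
apply: (ae_distribution (A := (g \o s) @^-1` Q)).
  by rewrite -[X in measurable X]setTI; exact: mgs'.
by apply: filterS Qg => w; rewrite -{1}gsphi.
Qed.

Lemma measurable_dot d (Omega : measurableType d) (R : realType) (k : nat)
    (f : Omega -> k.-tuple R) (b : k.-tuple R) :
  measurable_fun [set: Omega] f ->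
  measurable_fun [set: Omega] (fun w => dot (f w) b).
Proof.
move=> mf; apply: measurable_sum => j.
apply: measurable_funM => //.
exact: (measurableT_comp (measurable_tnth j) mf).
Qed.

Section latent_space.
Context (R : realType) (T k : nat).
Implicit Types b : k.-tuple R.

Definition residual b (t : 'I_T) (w : latent_space R T k) : R :=
  tnth w.1.1 t - dot (tnth w.1.2 t) b.

Lemma measurable_residual b t : measurable_fun setT (residual b t).
Proof.
apply: measurable_funB.
  apply: (measurableT_comp (measurable_tnth t)).
  exact: (measurableT_comp measurable_fst).
apply: measurable_dot; apply: (measurableT_comp (measurable_tnth t)).
exact: (measurableT_comp measurable_snd).
Qed.

Lemma measurable_latent_XA :
  measurable_fun setT (fun w : latent_space R T k => (w.1.2, w.2)).
Proof.
apply: measurable_fun_pair => //.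
exact: (measurableT_comp measurable_snd).
Qed.

Lemma measurable_disturbance (t : 'I_T) :
  measurable_fun setT (fun w : struct_space R T k => tnth w.2 t).
Proof. exact: (measurableT_comp (measurable_tnth t)). Qed.

(** Keeping [w] whole as first component makes [fst] a left inverse and preserves (Y, X, A) by
    computation. *)
Definition add_disturbance b (w : latent_space R T k) : struct_space R T k :=
  (w, [tuple residual b t w - w.2 | t < T]).

Lemma measurable_add_disturbance b : measurable_fun setT (add_disturbance b).
Proof.
apply: measurable_fun_pair => //; apply/measurable_fun_tnthP => t.
rewrite (_ : _ \o _ = (fun w => residual b t w - w.2)).
  by apply: measurable_funB => //; exact: measurable_residual.
by apply/funext => w /=; rewrite tnth_mktuple.
Qed.

Lemma structural_feasible (tau : R) (Pobs : probability (obs_space R T k) R) b :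
  structural_laws tau Pobs b !=set0 -> feasible_couplings tau Pobs b !=set0.
Proof.
case=> Ps [obs out quant].
pose phi : {mfun struct_space R T k >-> latent_space R T k} :=
  mfun_Sub (mem_set (@measurable_fst _ _ (latent_space R T k) (T.-tuple R))).
exists (distribution Ps phi); split; first exact: obs.
(* The zero disturbance is an arbitrary filler: [s] only has to preserve (X, A). *)
pose s (w : latent_space R T k) : struct_space R T k := (w, [tuple 0 | _ < T]).
move=> t; have [le lt] := quant t.
split.
- apply: (cond_prob_as_distribution (s := s) _ _ _ _ _ _ _ le) => //.
  + exact: measurable_latent_XA.
  + apply: measurable_bool_set; apply: measurable_fun_ler => //.
    exact: measurable_disturbance.
  + apply: measurable_bool_set; apply: measurable_fun_ler => //.
    exact: measurable_residual.
  (* Substituting the outcome equation for Y_t reduces the residual to A + U_t, and A + U_t <= A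
     means U_t <= 0. *)
  + apply: filterS (out t) => w /= ->.
    by rewrite addrAC [dot _ _ + _]addrC addrK gerDl.
  + by apply: measurable_bool_set; exact: measurable_fun_ler.
- apply: (cond_prob_as_distribution (s := s) _ _ _ _ _ _ _ lt) => //.
  + exact: measurable_latent_XA.
  + apply: measurable_bool_set; apply: measurable_fun_ltr => //.
    exact: measurable_disturbance.
  + apply: measurable_bool_set; apply: measurable_fun_ltr => //.
    exact: measurable_residual.
  + apply: filterS (out t) => w /= ->.
    by rewrite addrAC [dot _ _ + _]addrC addrK gtrDl.
  + by apply: measurable_bool_set; exact: measurable_fun_ler.
Qed.

Lemma feasible_structural (tau : R) (Pobs : probability (obs_space R T k) R) b :
  feasible_couplings tau Pobs b !=set0 -> structural_laws tau Pobs b !=set0.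
Proof.
case=> pi [obs quant].
pose phi : {mfun latent_space R T k >-> struct_space R T k} :=
  mfun_Sub (mem_set (measurable_add_disturbance b)).
exists (distribution pi phi); split; first exact: obs.
  move=> t; apply: (ae_distribution (A := [set w | _ = _])).
    have mRes : measurable_fun setT
        (fun w : struct_space R T k => residual b t w.1).
      exact: (measurableT_comp (measurable_residual b t)).
    (* With X_t'b moved to the left, the outcome equation equates two measurable real functions, so
       it is a measurable event, as [ae_distribution] requires. *)
    rewrite (_ : [set w | _ = _] =
        [set w | residual b t w.1 == w.1.2 + tnth w.2 t]).
      apply: measurable_bool_set; apply: measurable_fun_eqr => //.
      apply: measurable_funD; last exact: measurable_disturbance.
      exact: (measurableT_comp measurable_snd).
    by apply/seteqP; split=> w /=;
      rewrite subr_eq -[dot _ _ + _ + _]addrA [dot _ _ + _]addrC => /eqP.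
  apply: filterE => w.
  by rewrite /= tnth_mktuple /residual addrC -[_ - _ - _]addrA -opprD subrK.
move=> t; have [le lt] := quant t.
split.
(* Here [s] forgets U, which preserves (X, A). The two events correspond at every point, as U_t is
   the residual minus A by construction. *)
- apply: (cond_prob_as_distribution (s := fst) _ _ _ _ _ _ _ le) => //.
  + exact: (measurableT_comp measurable_latent_XA measurable_fst).
  + apply: measurable_bool_set; apply: measurable_fun_ler => //.
    exact: measurable_residual.
  + apply: measurable_bool_set; apply: measurable_fun_ler => //.
    exact: measurable_disturbance.
  + by apply: filterE => w /=; rewrite tnth_mktuple subr_le0.
  + by apply: measurable_bool_set; exact: measurable_fun_ler.
- apply: (cond_prob_as_distribution (s := fst) _ _ _ _ _ _ _ lt) => //.
  + exact: (measurableT_comp measurable_latent_XA measurable_fst).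
  + apply: measurable_bool_set; apply: measurable_fun_ltr => //.
    exact: measurable_residual.
  + apply: measurable_bool_set; apply: measurable_fun_ltr => //.
    exact: measurable_disturbance.
  + by apply: filterE => w /=; rewrite tnth_mktuple subr_lt0.
  + by apply: measurable_bool_set; exact: measurable_fun_ler.
Qed.

End latent_space.

Theorem theorem4p2 (R : realType) (T k : nat) (hT : (1 <= T)%N)
  (hk : (1 <= k)%N) (tau : R) (htau : 0 < tau < 1)
  (calB : set (k.-tuple R)) (Pobs : probability (obs_space R T k) R) :
  [/\ theta_str tau Pobs calB = theta_coup tau Pobs calB,
      forall b : k.-tuple R, theta_coup tau Pobs calB b ->
        exists Ps, structural_laws tau Pobs b Ps &
      forall b : k.-tuple R, calB b -> ~ theta_coup tau Pobs calB b ->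
        ~ exists Ps, structural_laws tau Pobs b Ps].
Proof.
split.
- apply/seteqP; split=> b [calBb].
    by move=> /structural_feasible.
  by move=> /feasible_structural.
- by move=> b [_ /feasible_structural].
- by move=> b calBb; apply: contra_not => /structural_feasible.
Qed.
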